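(* Let $R\in\mathcal{H}_0$ be an integrally closed local ring such that $R\neq T(R)$. If the maximal ideal $M$ of $R$ is finitely generated, then there is no ring $T$ properly containing $R$ (as a subring) such that $\mathrm{Spec}(R)=\mathrm{Spec}(T)$.
   Context: All rings are commutative with nonzero identity, and subrings share the identity of the larger ring. A local ring is a ring with a unique maximal ideal (not necessarily Noetherian). $T(R)$ is the total quotient ring of $R$; $\mathrm{Nil}(R)$ is the set of nilpotent elements of $R$; $Z(R)$ is the set of zero-divisors of $R$. $R$ is integrally closed if it equals its integral closure $R'$ in $T(R)$. A prime ideal of $R$ is divided if it is comparable (under inclusion) to every ideal of $R$. $\mathcal{H}$ is the class of all rings $R$ such that $\mathrm{Nil}(R)$ is a divided prime ideal of $R$, and $\mathcal{H}_0$ is the class of all $R\in\mathcal{H}$ with $\mathrm{Nil}(R)=Z(R)$. For a subring $R$ of $T$, $\mathrm{Spec}(R)=\mathrm{Spec}(T)$ means that $R$ and $T$ have literally the same prime ideals: every prime ideal of $R$ is (as a subset of $T$) a prime ideal of $T$, and every prime ideal of $T$ is contained in $R$ and is a prime ideal of $R$. The ring $T$ is not assumed to be contained in $T(R)$. *)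

(* Defs.v *)
From HB Require Import structures.
From mathcomp Require Import all_boot all_order all_algebra.
From mathcomp Require Import generic_quotient ring_quotient.
From mathcomp Require Import boolp classical_sets.
From mathcomp Require Import ring.

Set Implicit Arguments.
Unset Strict Implicit.
Unset Printing Implicit Defensive.

Import GRing.Theory.
Local Open Scope ring_scope.
Local Open Scope quotient_scope.
Local Open Scope classical_set_scope.

Section Ideals.
Variable R : comNzRingType.
Implicit Types I P M : set R.

(* Improper ideals are allowed here, whereas the library's [idealr_closed]
   includes [1 \notin I]. *)
Definition ideal I : Prop :=
  0 \in I /\ forall a, {in I &, forall u v, a * u + v \in I}.

Definition prime_ideal P : Prop :=
  idealr_closed (mem P) /\ prime_idealr_closed (mem P).

Definition maximal_ideal M : Prop :=
  idealr_closed (mem M) /\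
  forall I, idealr_closed (mem I) -> M `<=` I -> I = M.

Definition finitely_generated I : Prop :=
  exists (n : nat) (g : 'I_n -> R),
    I = [set x | exists c : 'I_n -> R, x = \sum_(i < n) c i * g i].

Definition divided_prime P : Prop :=
  prime_ideal P /\ forall I, ideal I -> P `<=` I \/ I `<=` P.

End Ideals.

Section RingClasses.
Variable R : comNzRingType.

Definition local_ring : Prop := exists! M : set R, maximal_ideal M.

Definition Nil : set R := [set x | exists n : nat, x ^+ n = 0].

Definition zero_divisors : set R := [set x | exists2 y, y != 0 & x * y = 0].

Definition class_H : Prop := divided_prime Nil.

Definition class_H0 : Prop := class_H /\ Nil = zero_divisors.

End RingClasses.

Arguments Nil R : clear implicits.
Arguments zero_divisors R : clear implicits.
Arguments local_ring R : clear implicits.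
Arguments class_H R : clear implicits.
Arguments class_H0 R : clear implicits.

(* The total quotient ring T(R), built as in [mathcomp.algebra.fraction] but
   with the elements outside Z(R), rather than the nonzero ones, as
   denominators. *)
Module TotalQuotient.
Section TotalQuotient.
Variable R : comNzRingType.

Lemma regularP (s : R) :
  reflect (forall x, s * x = 0 -> x = 0) (s \notin zero_divisors R).
Proof.
apply: (iffP idP) => [sZ x sx0 | sreg].
  by apply/eqP; apply: contraNT sZ => x0; rewrite inE; exists x.
by apply/negP; rewrite inE => -[y /eqP y0 /sreg].
Qed.

Lemma regular1 : 1 \notin zero_divisors R.
Proof. by apply/regularP => x; rewrite mul1r. Qed.

Lemma regularM s t : s \notin zero_divisors R -> t \notin zero_divisors R ->
  s * t \notin zero_divisors R.
Proof.
move=> /regularP sreg /regularP treg; apply/regularP => x.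
by rewrite -mulrA => /sreg/treg.
Qed.

Lemma regular_inj s x y : s \notin zero_divisors R -> s * x = s * y -> x = y.
Proof.
move=> /regularP sreg sxy; apply/eqP; rewrite -subr_eq0; apply/eqP/sreg.
by rewrite mulrBr sxy subrr.
Qed.

Record frac := Frac { numden :> R * R; _ : numden.2 \notin zero_divisors R }.

HB.instance Definition _ := [isSub for numden].
HB.instance Definition _ := [Choice of frac by <:].

Lemma den_regular (x : frac) : x.2 \notin zero_divisors R.
Proof. by case: x. Qed.

Definition mkfrac (a s : R) (hs : s \notin zero_divisors R) : frac :=
  @Frac (a, s) hs.

Definition equivf (x y : frac) : bool := x.1 * y.2 == x.2 * y.1.

Lemma equivf_refl : reflexive equivf.
Proof. by move=> x; rewrite /equivf mulrC. Qed.

Lemma equivf_sym : symmetric equivf.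
Proof.
by move=> x y; rewrite /equivf eq_sym [x.2 * _]mulrC [x.1 * _]mulrC.
Qed.

Lemma equivf_trans : transitive equivf.
Proof.
move=> y x z; rewrite /equivf => /eqP xy /eqP yz.
apply/eqP/(regular_inj (den_regular y)).
have -> : y.2 * (x.1 * z.2) = (x.1 * y.2) * z.2 by ring.
rewrite xy.
have -> : x.2 * y.1 * z.2 = x.2 * (y.1 * z.2) by ring.
by rewrite yz; ring.
Qed.

Canonical equivf_equiv := EquivRel equivf equivf_refl equivf_sym equivf_trans.

Definition type := {eq_quot equivf}.

HB.instance Definition _ : EqQuotient _ equivf type := EqQuotient.on type.
HB.instance Definition _ := Choice.on type.

Lemma pi_eqP (x y : frac) :
  reflect (x.1 * y.2 = x.2 * y.1) (x == y %[mod type]).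
Proof. by rewrite eqmodE; apply: eqP. Qed.

Lemma repr_pi (x : frac) :
  x.1 * (repr (\pi_type x)).2 = x.2 * (repr (\pi_type x)).1.
Proof. by apply/pi_eqP; rewrite reprK. Qed.

Definition to_frac (a : R) : frac := mkfrac a regular1.
Definition inj := lift_embed type to_frac.
Canonical inj_pi_morph := PiEmbed inj.

Definition addf (x y : frac) : frac :=
  mkfrac (x.1 * y.2 + y.1 * x.2) (regularM (den_regular x) (den_regular y)).
Definition add := lift_op2 type addf.

Lemma pi_add : {morph \pi : x y / addf x y >-> add x y}.
Proof.
move=> x y; unlock add; apply/eqP/pi_eqP => /=.
have := repr_pi x; have := repr_pi y.
case: (repr _) => -[c t] /= _; case: (repr _) => -[d u] /= _ hy hx.
have -> : (x.1 * y.2 + y.1 * x.2) * (u * t) =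
  (x.1 * u) * (y.2 * t) + (y.1 * t) * (x.2 * u) by ring.
by rewrite hx hy; ring.
Qed.
Canonical pi_add_morph := PiMorph2 pi_add.

Definition oppf (x : frac) : frac := mkfrac (- x.1) (den_regular x).
Definition opp := lift_op1 type oppf.

Lemma pi_opp : {morph \pi : x / oppf x >-> opp x}.
Proof.
move=> x; unlock opp; apply/eqP/pi_eqP => /=.
by rewrite mulNr mulrN repr_pi.
Qed.
Canonical pi_opp_morph := PiMorph1 pi_opp.

Definition mulf (x y : frac) : frac :=
  mkfrac (x.1 * y.1) (regularM (den_regular x) (den_regular y)).
Definition mul := lift_op2 type mulf.

Lemma pi_mul : {morph \pi : x y / mulf x y >-> mul x y}.
Proof.
move=> x y; unlock mul; apply/eqP/pi_eqP => /=.
by rewrite mulrACA !repr_pi mulrACA.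
Qed.
Canonical pi_mul_morph := PiMorph2 pi_mul.

Lemma addA : associative add.
Proof.
elim/quotW=> x; elim/quotW=> y; elim/quotW=> z; rewrite !piE.
by apply/eqP/pi_eqP => /=; ring.
Qed.

Lemma addC : commutative add.
Proof.
elim/quotW=> x; elim/quotW=> y; rewrite !piE.
by apply/eqP/pi_eqP => /=; ring.
Qed.

Lemma add0 : left_id (inj 0) add.
Proof. by elim/quotW=> x; rewrite !piE; apply/eqP/pi_eqP => /=; ring. Qed.

Lemma addN : left_inverse (inj 0) opp add.
Proof. by elim/quotW=> x; rewrite !piE; apply/eqP/pi_eqP => /=; ring. Qed.

HB.instance Definition _ := GRing.isZmodule.Build type addA addC add0 addN.

Lemma mulA : associative mul.
Proof.
elim/quotW=> x; elim/quotW=> y; elim/quotW=> z; rewrite !piE.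
by apply/eqP/pi_eqP => /=; ring.
Qed.

Lemma mulC : commutative mul.
Proof.
elim/quotW=> x; elim/quotW=> y; rewrite !piE.
by apply/eqP/pi_eqP => /=; ring.
Qed.

Lemma mul1 : left_id (inj 1) mul.
Proof. by elim/quotW=> x; rewrite !piE; apply/eqP/pi_eqP => /=; ring. Qed.

Lemma mulDl : left_distributive mul add.
Proof.
elim/quotW=> x; elim/quotW=> y; elim/quotW=> z; rewrite !piE.
by apply/eqP/pi_eqP => /=; ring.
Qed.

Lemma inj_injective : injective inj.
Proof.
move=> a b; rewrite !piE => /eqP/pi_eqP /=.
by rewrite mulr1 mul1r.
Qed.

Lemma nonzero1 : inj 1 != inj 0.
Proof. by rewrite (inj_eq inj_injective) oner_eq0. Qed.

HB.instance Definition _ :=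
  GRing.Zmodule_isComNzRing.Build type mulA mulC mul1 mulDl nonzero1.

Lemma inj_is_zmod_morphism : zmod_morphism inj.
Proof.
move=> a b; rewrite -[inj a - _]/(add (inj a) (opp (inj b))) !piE.
by apply/eqP/pi_eqP => /=; ring.
Qed.

Lemma inj_is_monoid_morphism : monoid_morphism inj.
Proof.
split=> // a b; rewrite -[inj a * _]/(mul (inj a) (inj b)) !piE.
by apply/eqP/pi_eqP => /=; ring.
Qed.

HB.instance Definition _ :=
  GRing.isZmodMorphism.Build R type inj inj_is_zmod_morphism.
HB.instance Definition _ :=
  GRing.isMonoidMorphism.Build R type inj inj_is_monoid_morphism.

End TotalQuotient.
End TotalQuotient.
HB.export TotalQuotient.

Definition total_quotient (R : comNzRingType) : comNzRingType :=
  TotalQuotient.type R.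

Definition to_tq (R : comNzRingType) : {rmorphism R -> total_quotient R} :=
  @TotalQuotient.inj R.

Arguments to_tq R : clear implicits.

Lemma to_tq_inj (R : comNzRingType) : injective (to_tq R).
Proof. exact: TotalQuotient.inj_injective. Qed.

Lemma to_tq_unit (R : comNzRingType) (s : R) :
  s \notin zero_divisors R -> exists z, to_tq R s * z = 1.
Proof.
move=> hs; exists (\pi_(TotalQuotient.type R) (TotalQuotient.mkfrac 1 hs)).
rewrite -(rmorph1 (to_tq R)) -[_ * _]/(TotalQuotient.mul _ _) /to_tq /=; apply/eqP.
by rewrite !piE; apply/eqP => /=; ring.
Qed.

Lemma total_quotientP (R : comNzRingType) (z : total_quotient R) :
  exists (a s : R), s \notin zero_divisors R /\ z * to_tq R s = to_tq R a.
Proof.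
elim/quotW: z => x; exists x.1, x.2.
split; first exact: TotalQuotient.den_regular.
apply/eqP; rewrite -[_ * _]/(TotalQuotient.mul _ _) /to_tq /=.
by rewrite !piE; apply/eqP => /=; ring.
Qed.

Definition integral_closure (R : comNzRingType) : set (total_quotient R) :=
  [set z | integralOver (to_tq R) z].

Arguments integral_closure R : clear implicits.

Definition integrally_closed (R : comNzRingType) : Prop :=
  integral_closure R = range (to_tq R).

Arguments integrally_closed R : clear implicits.

(* Meant for injective iota, which makes R a subring of T up to renaming:
   primes of R are read as subsets of T through their image, and primes of T
   contained in R are read back through their preimage. *)
Definition same_Spec (R T : comNzRingType) (iota : {rmorphism R -> T}) : Prop :=
  (forall P : set R, prime_ideal P -> prime_ideal (iota @` P)) /\
  (forall Q : set T, prime_ideal Q ->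
     Q `<=` range iota /\ prime_ideal (iota @^-1` Q)).

(* Main.v *)
Require Import Defs.
From mathcomp Require Import all_boot all_order all_algebra.
From mathcomp Require Import boolp classical_sets.
From mathcomp Require Import ring.

(** Suppose [Spec R = Spec T].  As [R <> T(R)], the maximal ideal [M] contains
some [s] outside [Nil R = Z R].  [M] is also an ideal of [T], so each [t] in
[T] multiplies [M] into itself, and on [M] it acts like the element [ts/s] of
[T(R)].  Since [M] is finitely generated and contains a regular element, the
determinant trick makes [ts/s] integral over [R], hence equal to some [r] in
[R].  Then [(t - r)s = 0] lies in [Nil R], which is a prime ideal of [T]
missing [s]; so [t - r] is in [Nil R] and [t] is in [R]. *)

Import GRing.Theory.
Local Open Scope ring_scope.
Local Open Scope classical_set_scope.

Section Ideals.
Context {R : comNzRingType}.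
Implicit Types I P M : set R.

Lemma prime_idealMl {P} : prime_ideal P -> forall a x, P x -> P (a * x).
Proof.
move=> [[P0 _ PD] _] a x Px; have := PD a x 0; rewrite addr0 !inE.
by apply; rewrite ?inE //; move: P0; rewrite inE.
Qed.

Lemma maximal_ideal_notin {M s} : maximal_ideal M -> ~ M s ->
  exists2 m, M m & exists r, m + r * s = 1.
Proof.
move=> [[M0 _ MD] Mmax] sM; apply: contrapT => no1.
have memM x : (x \in M) = (M x) :> Prop by rewrite inE.
(* [I] is the ideal [M + Rs]. If it missed 1 it would be proper, so equal to [M] by maximality,
   although it contains [s]. *)
pose I := [set x | exists2 m, M m & exists r, x = m + r * s].
apply: sM; rewrite -(Mmax I) //.
- by exists 0; [rewrite -memM | exists 1; rewrite add0r mul1r].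
- split.
  + by rewrite inE; exists 0; [rewrite -memM | exists 0; rewrite mul0r addr0].
  + by apply/negP; rewrite inE => -[m Mm [r e]]; apply: no1; exists m => //; exists r.
  + move=> a x y; rewrite !inE => -[m Mm [r ->]] [m' Mm' [r' ->]].
    exists (a * m + m'); first by rewrite -memM; apply: MD; rewrite inE.
    by exists (a * r + r'); ring.
- by move=> m Mm; exists m => //; exists 0; rewrite mul0r addr0.
Qed.

Lemma maximal_ideal_prime {M} : maximal_ideal M -> prime_ideal M.
Proof.
move=> hM; have [[M0 M1 MD] _] := hM; split=> // a b abM.
apply/orP; have [aM|aM] := boolP (a \in M); [by left | right].
have [|m Mm [r e]] := @maximal_ideal_notin M a hM.
  by move=> /mem_set Ma; rewrite Ma in aM.
have -> : b = b * m + r * (a * b) by rewrite -[LHS]mul1r -e; ring.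
apply: (MD); first by rewrite inE.
by rewrite -[_ * _]addr0; apply: MD.
Qed.

End Ideals.

Lemma unit_regular_tq {R : comNzRingType} :
    (forall s, s \notin zero_divisors R -> exists r, r * s = 1) ->
  range (to_tq R) = [set: total_quotient R].
Proof.
move=> unitR; apply/seteqP; split=> // z _.
have [a [s [/unitR[r rs] zs]]] := total_quotientP z.
exists (a * r) => //; rewrite rmorphM -zs -mulrA -rmorphM.
by rewrite [s * r]mulrC rs rmorph1 mulr1.
Qed.

(** Modulo [M] some [r * s] is 1, so [r * s = 1 - m] with [m] nilpotent; the finite geometric series
    in [m] inverts it. *)
Lemma maximal_sub_Nil_unit {R : comNzRingType} {M : set R} {s} :
  maximal_ideal M -> M `<=` Defs.Nil R -> ~ M s -> exists r, r * s = 1.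
Proof.
move=> hM MN /(maximal_ideal_notin hM)[m /MN[n mn0] [r e]].
exists ((\sum_(i < n) m ^+ i) * r).
have -> : (\sum_(i < n) m ^+ i) * r * s = - ((m - 1) * \sum_(i < n) m ^+ i).
  by rewrite -e; ring.
by rewrite -subrX1 mn0 sub0r opprK.
Qed.

(** Determinant trick: [z - f(C)] kills the column of the [g i], and multiplying by its adjugate
    shows that its determinant kills each of them. *)
Lemma char_poly_act {R A : comNzRingType} (f : {rmorphism R -> A}) {n}
    (C : 'M[R]_n) (g : 'I_n -> A) (z : A) :
    (forall i, z * g i = \sum_j f (C i j) * g j) ->
  forall i, (map_poly f (char_poly C)).[z] * g i = 0.
Proof.
move=> zg i; pose B := z%:M - map_mx f C; pose G := \col_j g j.
have BG : B *m G = 0.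
  apply/matrixP => k l; rewrite mulmxBl mul_scalar_mx !mxE zg.
  by apply/eqP; rewrite subr_eq0; apply/eqP/eq_bigr => j _; rewrite !mxE.
have -> : (map_poly f (char_poly C)).[z] = \det B.
  (* Evaluation at [z] is a ring morphism, so it commutes with the determinant. *)
  rewrite map_char_poly -[LHS]/(horner_eval z _) -det_map_mx; congr (\det _).
  apply/matrixP => k l.
  by rewrite !mxE /= /horner_eval hornerD hornerN hornerC hornerMn hornerX.
have /matrixP/(_ i ord0) : (\det B)%:M *m G = 0.
  by rewrite -mul_adj_mx -mulmxA BG mulmx0.
by rewrite mul_scalar_mx !mxE.
Qed.

(** Multiplication by [z] has a matrix over [R] on the generators of [M]. Its characteristic
    polynomial at [z] kills their images, hence also [f s], which is invertible, so it vanishes. *)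
Lemma integral_stabilizer {R A : comNzRingType} (f : {rmorphism R -> A})
    (M : set R) (s : R) (u z : A) :
    finitely_generated M -> M s -> f s * u = 1 ->
    (forall m, M m -> exists2 m', M m' & z * f m = f m') ->
  integralOver f z.
Proof.
move=> [n [g ->]] [c ->] su zM.
have /choice[C hC] i : exists c : 'I_n -> R, z * f (g i) = \sum_j f (c j) * f (g j).
  have [|_ [c' ->] ->] := zM (g i).
    exists (fun j => (j == i)%:R); rewrite (bigD1 i) //= eqxx mul1r.
    by rewrite big1 ?addr0 // => j /negPf ->; rewrite mul0r.
  by exists c'; rewrite rmorph_sum; apply: eq_bigr => j _; rewrite rmorphM.
exists (char_poly (\matrix_(i, j) C i j)); first exact: char_poly_monic.
have kill := @char_poly_act _ _ f n (\matrix_(i, j) C i j) (f \o g) z.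
move: su; rewrite rmorph_sum => su.
apply/eqP; rewrite -[LHS]mulr1 -su mulrA mulr_sumr big1 ?mul0r // => i _.
rewrite rmorphM mulrCA kill ?mulr0 // => k; rewrite hC.
by apply: eq_bigr => j _; rewrite mxE.
Qed.

Theorem proposition2p14 (R : comNzRingType) (hH0 : class_H0 R)
    (hic : integrally_closed R) (hloc : local_ring R)
    (hT : range (to_tq R) <> [set: total_quotient R])
    (M : set R) (hM : maximal_ideal M) (hfg : finitely_generated M) :
  ~ (exists (T : comNzRingType) (iota : {rmorphism R -> T}),
       [/\ injective iota, range iota <> [set: T] & same_Spec iota]).
Proof.
move=> [T [iota [inj_iota rangeN [SpecRT _]]]]; apply: rangeN.
have [[Nprime _] NZ] := hH0.
(* Were [M] inside the nilradical, each regular element would lie outside [M] and be a unit, forcing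
   [R = T(R)]. *)
have [s Ms sN] : exists2 s, M s & ~ Defs.Nil R s.
  apply: contrapT => noS; apply: hT; apply: unit_regular_tq => s sZ.
  have MN : M `<=` Defs.Nil R by move=> m Mm; apply: contrapT => mN; apply: noS; exists m.
  apply: (maximal_sub_Nil_unit hM MN) => /MN.
  by rewrite NZ => sZ'; move: sZ => /negP; apply; rewrite inE.
have [u su] : exists u, to_tq R s * u = 1.
  by apply: to_tq_unit; apply/negP; rewrite -NZ inE.
apply/seteqP; split=> // t _.
have tM m : M m -> exists2 m', M m' & iota m' = t * iota m.
  by move=> Mm; apply: (prime_idealMl (SpecRT _ (maximal_ideal_prime hM))); exists m.
have [w Mw ew] := tM s Ms.
have : integral_closure R (to_tq R w * u).
  apply: (integral_stabilizer _ M s u) => // m /tM[m' Mm' em']; exists m' => //.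
  (* Both sides map to [t * s * m] in [T]; this carries the action of [t] on [M] over to [w/s] in
     [T(R)]. *)
  have wm : w * m = s * m'.
    by apply: inj_iota; rewrite !rmorphM ew em'; ring.
  by rewrite mulrAC -rmorphM wm rmorphM mulrAC su mul1r.
rewrite hic => -[r _ er].
have wrs : w = r * s.
  by apply: to_tq_inj; rewrite rmorphM er -mulrA [u * _]mulrC su mulr1.
have trs : (t - iota r) * iota s = 0.
  by rewrite mulrBl -ew -rmorphM wrs subrr.
have [[N0 _ _] Npr] := SpecRT _ Nprime.
have := Npr (t - iota r) (iota s); rewrite trs => /(_ N0) /orP[]; rewrite inE.
  by move=> [v _ ev]; exists (v + r) => //; rewrite rmorphD ev subrK.
(* The other factor [iota s] cannot lie in the image of the nilradical: by injectivity [s] would be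
   nilpotent. *)
by move=> [v Nv /inj_iota ev]; case: sN; rewrite -ev.
Qed.
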